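(* For all $n\ge 1$, $$A_{1012}(n)=\sum_{i=0}^{n-1}\binom{n-1}{i}C_i,$$ where $C_i=\frac{1}{i+1}\binom{2i}{i}$ is the $i$-th Catalan number.
   Context: An ascent in a sequence $x_1\cdots x_k$ is an index $j$ with $x_j<x_{j+1}$; $\mathrm{asc}(x)$ is the number of ascents. An ascent sequence of length $n$ is a sequence $x_1\cdots x_n$ of non-negative integers with $x_1=0$ and $x_i\le \mathrm{asc}(x_1\cdots x_{i-1})+1$ for $1<i\le n$. A sequence $\pi$ contains a pattern $\tau=\tau_1\cdots\tau_m$ (a sequence of non-negative integers) if there are indices $f(1)<\cdots<f(m)$ such that for all $i,j$: $\pi_{f(i)}<\pi_{f(j)}$ iff $\tau_i<\tau_j$, and $\pi_{f(i)}>\pi_{f(j)}$ iff $\tau_i>\tau_j$; otherwise $\pi$ avoids $\tau$. $A_\tau(n)$ is the number of ascent sequences of length $n$ avoiding $\tau$. *)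

(* Defs.v *)
From mathcomp Require Import all_boot.

Set Implicit Arguments.
Unset Strict Implicit.
Unset Printing Implicit Defensive.

(* Positions are 0-based throughout: the entry x_i is [nth 0 x (i - 1)]. *)

Definition asc (x : seq nat) : nat :=
  \sum_(j < (size x).-1) (nth 0 x j < nth 0 x j.+1).

Definition ascent_seq (x : seq nat) : bool :=
  (nth 0 x 0 == 0) &&
  [forall i : 'I_(size x), (0 < i) ==> (nth 0 x i <= asc (take i x) + 1)].

Definition contains (p t : seq nat) : bool :=
  [exists f : {ffun 'I_(size t) -> 'I_(size p)},
    [forall i : 'I_(size t), forall j : 'I_(size t), (i < j) ==> (f i < f j)] &&
    [forall i : 'I_(size t), forall j : 'I_(size t),
      ((nth 0 p (f i) < nth 0 p (f j)) == (nth 0 t i < nth 0 t j)) &&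
      ((nth 0 p (f i) > nth 0 p (f j)) == (nth 0 t i > nth 0 t j))]].

Definition avoids (p t : seq nat) : bool := ~~ contains p t.

(* The entries of an ascent sequence of length n are smaller than n (see
   [ascent_seq_bound]), so counting over n-tuples of elements of 'I_n loses
   nothing; [A_spec] states this for sequences of arbitrary naturals. *)
Definition A (t : seq nat) (n : nat) : nat :=
  #|[set x : n.-tuple 'I_n |
      ascent_seq (map val x) && avoids (map val x) t]|.

(* The division is exact, see [catalan_exact]. *)
Definition catalan (i : nat) : nat := 'C(2 * i, i) %/ i.+1.

Lemma asc_le x : asc x <= (size x).-1.
Proof.
rewrite /asc -[X in _ <= X]card_ord -sum1_card.
by apply: leq_sum => i _; case: (_ < _).
Qed.

Lemma ascent_seq_bound x : ascent_seq x -> all (fun k => k < size x) x.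
Proof.
case/andP=> /eqP x0 /forallP H; apply/(all_nthP 0) => i lti.
case: (posnP i) => [i0|i0]; first by move: lti; rewrite i0 x0.
have := H (Ordinal lti); rewrite /= i0 /= => Hi.
apply: leq_ltn_trans Hi _.
have := asc_le (take i x); rewrite size_take lti => Ha.
by apply: leq_ltn_trans lti; rewrite addn1 -[X in _ <= X](prednK i0).
Qed.

Lemma A_spec t n : exists s : seq (seq nat),
  [/\ uniq s,
      forall x, (x \in s) = [&& size x == n, ascent_seq x & avoids x t]
    & size s = A t n].
Proof.
pose S := [set x : n.-tuple 'I_n |
      ascent_seq (map val x) && avoids (map val x) t].
pose g (x : n.-tuple 'I_n) : seq nat := map val x.
exists (map g (enum S)); split.
- rewrite map_inj_uniq ?enum_uniq // => x y /(inj_map val_inj) exy.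
  exact: val_inj.
- move=> x; apply/mapP/and3P => [[y]|[/eqP szx ax avx]].
    rewrite mem_enum inE => /andP[ay avy] ->.
    by split; rewrite // size_map size_tuple.
  have bx := ascent_seq_bound ax; rewrite szx in bx.
  pose z : seq 'I_n := pmap insub x.
  have zx : map val z = x.
    by rewrite /z (pmap_filter (insubK _)); apply/all_filterP;
      apply: sub_all bx => k kn; rewrite insubT.
  have szz : size z == n by rewrite -(size_map val) zx szx.
  exists (Tuple szz); last by rewrite /g /= zx.
  by rewrite mem_enum inE /= zx ax avx.
- by rewrite size_map -cardE.
Qed.

Lemma catalan_exact i : i.+1 * catalan i = 'C(2 * i, i).
Proof.
rewrite mulnC; apply: divnK.
have := mul_bin_left (2 * i) i; rewrite mul2n -addnn addnK => e.
by rewrite -(Gauss_dvdr _ (coprimeSn i)) -e dvdn_mulr.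
Qed.

(* Main.v *)
Require Import Defs.
From mathcomp Require Import all_boot all_order all_algebra zify ring.

(** A 1012-avoiding ascent sequence is a restricted growth function (RGF): an
    ascent which is not to a new maximum exhibits a factor [b .. a b] with
    [a < b], after which no letter exceeds [b].  So we count 1012-avoiding RGFs.

    Such a word of length at least 2 is obtained in exactly one way from a
    shorter one, either by prepending 0 to the word with all letters increased
    by 1, or by inserting a new last 0.  A 0 may be inserted in a slot [u | v]
    iff the slot is active: no [b] of [u] occurs in [v] followed by some
    [c > b].  If a word has [k] active slots then prepending or appending 0
    leads to [k + 1], and the insertions of a non-final 0, which are possible
    only if the word does not end in 0, lead to [3, .., k] active slots.

    Let [K = C(x / (1 - x))] with [C] the Catalan series, so that
    [(1 - x) (K - 1) = x K^2], [H = K / (1 - x)] and [M = 1 / (1 - x K)].  The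
    kernel method gives [H M^(k - 2)] as the series of the number of
    descendants of a word with [k] active slots which does not end in 0.  At
    [k = 2] a final 0 makes no difference, so the word 0 contributes [H], whose
    coefficients are the binomial transform of the Catalan numbers. *)

Set Implicit Arguments.
Unset Strict Implicit.
Unset Printing Implicit Defensive.

(** * Generating the 1012-avoiding restricted growth functions *)

(** Testing the first [b] suffices: a larger letter after a later [b] also comes after the first. *)
Fixpoint climbs (b : nat) (s : seq nat) : bool :=
  if s is x :: s' then (if x == b then has (ltn b) s' else climbs b s')
  else false.

Definition active (u v : seq nat) : bool := ~~ has (climbs^~ v) u.

(** No occurrence of 1012 in [u ++ v] has its letter 0 in [v]. *)
Fixpoint avoids1012_after (u v : seq nat) : bool :=
  if v is a :: v' then
    all (fun b => (a < b) ==> ~~ climbs b v') u && avoids1012_after (rcons u a) v'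
  else true.

(** [m] is one more than the maximum of the letters read before [w]. *)
Fixpoint rgf_from (m : nat) (w : seq nat) : bool :=
  if w is a :: w' then (a <= m) && rgf_from (maxn m a.+1) w' else true.

Definition avoiding_rgf (w : seq nat) : bool :=
  rgf_from 0 w && avoids1012_after [::] w.

(** Only the slots weakly to the right of the boundary [u | v] are counted. *)
Fixpoint nactive (u v : seq nat) : nat :=
  active u v + if v is a :: v' then nactive (rcons u a) v' else 0.

Fixpoint insertions (u v : seq nat) : seq (seq nat) :=
  (if (0 \notin v) && active u v then [:: u ++ 0 :: v] else [::])
  ++ (if v is a :: v' then insertions (rcons u a) v' else [::]).

Definition children (w : seq nat) : seq (seq nat) :=
  (0 :: map succn w) :: if w is a :: v then insertions [:: a] v else [::].

Lemma climbs_cat_cons0 b s v : 0 < b -> climbs b (s ++ 0 :: v) = climbs b (s ++ v).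
Proof.
move=> b0; elim: s => [|x s IH] /=; first by case: b b0.
by rewrite IH !has_cat /=.
Qed.

Lemma climbs_rcons0 b s : climbs b (rcons s 0) = climbs b s.
Proof.
elim: s => [|x s IH] /=; first by case: b.
by rewrite IH has_rcons.
Qed.

Lemma climbs_map_succ b s : climbs b.+1 (map succn s) = climbs b s.
Proof. by elim: s => //= x s ->; rewrite eqSS has_map. Qed.

Lemma climbs0N s : 0 \notin s -> climbs 0 s = false.
Proof. by elim: s => //= -[|x] s IH; rewrite inE //= => /IH. Qed.

(** The nonzero last letter comes after every 0 and exceeds it. Hence, in a word not ending in 0, a
    slot with a 0 on both sides is inactive. *)
Lemma climbs0 s : 0 \in s -> last 0 s != 0 -> climbs 0 s.
Proof.
elim: s => //= x s IH; rewrite inE; case: (eqVneq x 0) => [-> _ l0|x0].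
  apply/hasP; exists (last 0 s); last by rewrite /= lt0n.
  by case: s l0 {IH} => //= y s _; rewrite mem_last.
move=> /= s0; rewrite (_ : last x s = last 0 s); first exact: IH.
by case: s s0 {IH}.
Qed.

Lemma active_nil u : active u [::].
Proof. by rewrite /active; elim: u. Qed.

Lemma eq_active u u' v : u =i u' -> active u v = active u' v.
Proof. by move=> e; rewrite /active (eq_has_r e). Qed.

Lemma eq_mem_rcons (u u' : seq nat) a : u =i u' -> rcons u a =i rcons u' a.
Proof. by move=> e x; rewrite !mem_rcons !inE e. Qed.

Lemma eq_nactive u u' v : u =i u' -> nactive u v = nactive u' v.
Proof.
elim: v u u' => [|a v IH] u u' e /=; rewrite (eq_active _ e) //.
by rewrite (IH _ _ (eq_mem_rcons a e)).
Qed.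

Lemma eq_avoids1012 u u' v : u =i u' -> avoids1012_after u v = avoids1012_after u' v.
Proof.
elim: v u u' => [|a v IH] u u' e //=.
by rewrite (eq_all_r e) (IH _ _ (eq_mem_rcons a e)).
Qed.

Lemma avoids1012_cons0 u v : avoids1012_after (0 :: u) v = avoids1012_after u v.
Proof. by elim: v u => //= a v IH u; rewrite IH. Qed.

Lemma avoids1012_rcons0 u v : avoids1012_after (rcons u 0) v = avoids1012_after u v.
Proof.
by rewrite -[RHS]avoids1012_cons0; apply: eq_avoids1012 => x; rewrite mem_rcons.
Qed.

Lemma avoids1012_map_succ u v :
  avoids1012_after (map succn u) (map succn v) = avoids1012_after u v.
Proof.
elim: v u => //= a v IH u; rewrite -map_rcons IH all_map; congr (_ && _).
by apply: eq_all => b /=; rewrite ltnS climbs_map_succ.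
Qed.

(** The new 0 can only play the letter 0 of the pattern, and it does so exactly when the slot is
    inactive. An earlier 0 does no harm because [v] contains none. *)
Lemma avoids1012_insert u s v : 0 \notin v ->
  avoids1012_after u (s ++ 0 :: v) = avoids1012_after u (s ++ v) && active (u ++ s) v.
Proof.
move=> v0; elim: s u => [|x s IH] u /=.
  rewrite avoids1012_rcons0 cats0 andbC; congr (_ && _).
  rewrite /active -all_predC; apply: eq_all => -[|b] //=; by rewrite climbs0N.
rewrite IH cat_rcons -andbA; congr (_ && _); apply: eq_all => b.
by case: b => //= b; rewrite climbs_cat_cons0.
Qed.

Lemma rgf_map_succ m w : rgf_from m.+1 (map succn w) = rgf_from m w.
Proof. by elim: w m => //= a w IH m; rewrite ltnS maxnSS IH. Qed.

Lemma rgf_insert m s v : 0 < m \/ s <> [::] ->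
  rgf_from m (s ++ 0 :: v) = rgf_from m (s ++ v).
Proof.
elim: s m => [|x s IH] m /= h.
  by case: h => // m0; rewrite (maxn_idPl _).
by rewrite IH //; left; rewrite leq_max orbT.
Qed.

Lemma avoiding_rgf_succ w : avoiding_rgf (0 :: map succn w) = avoiding_rgf w.
Proof.
by rewrite /avoiding_rgf /= max0n rgf_map_succ (avoids1012_rcons0 [::])
  (avoids1012_map_succ [::]).
Qed.

Lemma avoiding_rgf_insert s v : s <> [::] -> 0 \notin v ->
  avoiding_rgf (s ++ 0 :: v) = avoiding_rgf (s ++ v) && active s v.
Proof.
by move=> s0 v0; rewrite /avoiding_rgf rgf_insert ?avoids1012_insert ?andbA //; right.
Qed.

Lemma mem_insertions u v w : reflect
  (exists v1 v2, [/\ v = v1 ++ v2, 0 \notin v2, active (u ++ v1) v2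
                   & w = u ++ v1 ++ 0 :: v2])
  (w \in insertions u v).
Proof.
elim: v u => [|a v IH] u /=.
  rewrite cats0 active_nil inE; apply: (iffP eqP) => [->|].
    by exists [::], [::]; rewrite active_nil.
  by case=> [[|? ?]] [[|? ?]] [].
rewrite mem_cat; apply: (iffP orP) => [[]|].
- case: ifP => // /andP[v0 av]; rewrite inE => /eqP ->.
  by exists [::], (a :: v); rewrite cats0.
- case/IH => v1 [v2 [-> v0 av ->]]; exists (a :: v1), v2.
  by rewrite !cat_rcons in av *.
- case=> -[|b v1] [v2 []] /=.
    by move=> <- -> /=; rewrite cats0 => -> ->; left; rewrite inE.
  case=> <- ev v0 av ew; right; apply/IH; exists v1, v2.
  by rewrite !cat_rcons.
Qed.

Lemma children_avoiding_rgf w c : avoiding_rgf w -> c \in children w ->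
  avoiding_rgf c && (size c == (size w).+1).
Proof.
move=> gw; rewrite inE => /orP[/eqP ->|].
  by rewrite avoiding_rgf_succ gw /= size_map.
case: w gw => // a w gw /mem_insertions[v1 [v2 [ew v0 av ->]]].
rewrite catA avoiding_rgf_insert // /= -ew gw av /=.
by rewrite ew !size_cat /= addnS.
Qed.

Lemma avoiding_rgf_head a w : avoiding_rgf (a :: w) -> a = 0.
Proof. by case/andP => /= /andP[]; rewrite leqn0 => /eqP. Qed.

Lemma split_last0 (w : seq nat) : 0 \in w ->
  exists u v, w = u ++ 0 :: v /\ 0 \notin v.
Proof.
elim: w => // a w IH; rewrite inE.
case: (boolP (0 \in w)) => [/IH [u [v [-> v0]]] _|w0].
  by exists (a :: u), v.
by rewrite orbF => /eqP <-; exists [::], w.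
Qed.

(** If a second 0 occurs, deleting the last 0 gives the parent; otherwise the leading 0 is dropped
    and the other letters are decreased. *)
Lemma avoiding_rgf_child c : avoiding_rgf c -> 1 < size c ->
  exists2 w, avoiding_rgf w & c \in children w.
Proof.
case: c => // a c gc sc; have a0 := avoiding_rgf_head gc; subst a.
case: (boolP (0 \in c)) => [/split_last0[u [v [ec v0]]]|c0].
  move: gc; rewrite ec -cat_cons avoiding_rgf_insert // => /andP[gw av].
  exists (0 :: u ++ v) => //=; rewrite inE; apply/orP; right.
  by apply/mem_insertions; exists u, v.
exists (map predn c); last first.
  rewrite inE -map_comp map_id_in ?eqxx // => x xc /=; apply: prednK.
  by rewrite lt0n; apply: contraNneq c0 => <-.
rewrite -avoiding_rgf_succ -map_comp map_id_in // => x xc /=; apply: prednK.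
by rewrite lt0n; apply: contraNneq c0 => <-.
Qed.

(** A left inverse of [children], so distinct words have disjoint sets of children. Since [rem]
    deletes the first occurrence, the word is reversed to delete the last 0. *)
Definition parent (c : seq nat) : seq nat :=
  if 0 \in behead c then rev (rem 0 (rev c)) else map predn (behead c).

Lemma rem_rev_insert (u v : seq nat) : 0 \notin v ->
  rev (rem 0 (rev (u ++ 0 :: v))) = u ++ v.
Proof.
move=> v0; rewrite rev_cat rev_cons cat_rcons.
have -> : forall (x y : seq nat), 0 \notin x -> rem 0 (x ++ 0 :: y) = x ++ y.
  by elim=> //= z x IH y; rewrite inE negb_or eq_sym => /andP[/negPf -> /IH ->].
  by rewrite rev_cat !revK.
by rewrite mem_rev.
Qed.

Lemma parent_child w c : c \in children w -> parent c = w.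
Proof.
rewrite inE => /orP[/eqP ->|].
  rewrite /parent /=; case: ifP => [/mapP[] //|_].
  by rewrite -map_comp map_id_in.
case: w => // a w /mem_insertions[v1 [v2 [-> v0 av ->]]].
by rewrite /parent /= mem_cat inE eqxx orbT -cat_cons rem_rev_insert.
Qed.

Lemma insertions_uniq u v : uniq (insertions u v).
Proof.
elim: v u => [|a v IH] u /=; first by rewrite active_nil.
case: ifP => [/andP[v0 _]|_]; last exact: IH.
rewrite cat1s cons_uniq IH andbT.
apply/mem_insertions => -[v1 [v2 [ev v20 _]]].
rewrite cat_rcons => /eqP; rewrite eqseq_cat // eqxx /= => /eqP[a0 _].
by move: v0; rewrite -a0 inE eqxx.
Qed.

Lemma children_uniq w : uniq (children w).
Proof.
rewrite /children /=; case: w => // a w; rewrite insertions_uniq andbT.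
apply/mem_insertions => -[v1 [v2 [_ _ _]]] /= [_ e].
(* An insertion leaves a 0 after the first letter, whereas the prepended child has only positive
   letters there. *)
have: 0 \in a.+1 :: map succn w by rewrite e mem_cat inE eqxx orbT.
by rewrite -map_cons => /mapP[].
Qed.

Lemma uniq_flatten_children s : uniq s -> uniq (flatten (map children s)).
Proof.
elim: s => // w s IH; rewrite cons_uniq => /andP[ws us].
rewrite -[flatten _]/(children w ++ flatten (map children s)).
rewrite cat_uniq children_uniq (IH us) andbT.
apply/hasPn => c /flatten_mapP[w' w's /parent_child pc].
by apply: contra ws => /parent_child; rewrite pc => <-.
Qed.

Fixpoint descendants (r : nat) (s : seq (seq nat)) : seq (seq nat) :=
  if r is r'.+1 then descendants r' (flatten (map children s)) else s.

Definition generation (r : nat) : seq (seq nat) := descendants r [:: [:: 0]].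

Lemma descendantsSr r s :
  descendants r.+1 s = flatten (map children (descendants r s)).
Proof. by elim: r s => //= r IH s; rewrite -IH. Qed.

Lemma generation_uniq r : uniq (generation r).
Proof.
by elim: r => // r IH; rewrite /generation descendantsSr uniq_flatten_children.
Qed.

Lemma mem_generation r w : (w \in generation r) = avoiding_rgf w && (size w == r.+1).
Proof.
elim: r w => [|r IH] w.
  rewrite /generation inE; apply/eqP/andP => [->|[]] //.
  by case: w => [|a [|//]] // /avoiding_rgf_head ->.
rewrite /generation descendantsSr; apply/flatten_mapP/andP => [[p]|[gw sw]].
  by rewrite IH => /andP[gp /eqP <-] /(children_avoiding_rgf gp)/andP.
have [|p gp wp] := avoiding_rgf_child gw; first by rewrite (eqP sw).
exists p => //; rewrite IH gp /=.
by have /andP[_] := children_avoiding_rgf gp wp; rewrite (eqP sw) eqSS eq_sym.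
Qed.

(** The number of [r]-th generation descendants of a word with [k] active slots;
    [z] tells whether the word ends in 0. *)
Fixpoint continuations (r : nat) (z : bool) (k : nat) : nat :=
  if r is r'.+1 then
    continuations r' false k.+1 + continuations r' true k.+1 +
    (if z then 0 else \sum_(3 <= i < k.+1) continuations r' false i)
  else 1.

(** * Active slots of the children of a word *)

Lemma nactive_rcons0 u v : nactive u (rcons v 0) = (nactive u v).+1.
Proof.
have aE t s : active t (rcons s 0) = active t s.
  by congr (~~ _); apply: eq_has => b; rewrite climbs_rcons0.
elim: v u => [|a v IH] u /=; last by rewrite IH addnS -rcons_cons aE.
by rewrite !active_nil (aE _ [::]) active_nil.
Qed.

(** The leading 0 does not recur among the increased letters, so it deactivates no slot. The slot in
    front of it lies outside this count and accounts for the gain of one. *)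
Lemma nactive_succ u v : nactive (0 :: map succn u) (map succn v) = nactive u v.
Proof.
elim: v u => [|a v IH] u /=; rewrite ?active_nil //.
rewrite -map_rcons IH; congr (nat_of_bool _ + _).
rewrite -map_cons /active /= climbs0N; last by apply/mapP => -[].
by rewrite has_map; congr (~~ _); apply: eq_has => b; exact: (climbs_map_succ b (a :: v)).
Qed.

Lemma nactive_gt0 u v : 0 < nactive u v.
Proof. by elim: v u => [|a v IH] u /=; rewrite ?active_nil // addn_gt0 IH orbT. Qed.

(** The new 0 repeats one of [u] and a positive letter follows, so all slots from the end of [u] up
    to the new 0 become inactive. The later slots have the same set of letters before them as in the
    old word. *)
Lemma nactive_insert u s v : 0 \in u -> 0 \notin v -> v <> [::] ->
  nactive u (s ++ 0 :: v) = nactive (u ++ s) v.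
Proof.
move=> + v0 vn; elim: s u => [|a s IH] u u0 /=.
  rewrite (_ : active u _ = false); last first.
    apply/negbTE; rewrite negbK; apply/hasP; exists 0 => //=.
    case: v v0 vn => // -[|b] v; by rewrite inE.
  rewrite add0n cats0; apply: eq_nactive => x; rewrite mem_rcons inE.
  by case: eqP => // ->.
rewrite (_ : active u _ = false).
  by rewrite IH ?cat_rcons // mem_rcons inE u0 orbT.
apply/negbTE; rewrite negbK; apply/hasP; exists 0 => //.
apply: (@climbs0 (a :: s ++ 0 :: v)); first by rewrite inE mem_cat inE eqxx !orbT.
rewrite /= last_cat /=; case: v v0 vn {IH} => // b v v0 _ /=.
by apply: contra v0 => /eqP e; rewrite -{1}e mem_last.
Qed.

Lemma active0N u v : 0 \in u -> last 1 v != 0 -> active u v -> 0 \notin v.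
Proof.
move=> u0 lv /hasPn/(_ _ u0); apply: contra => v0; apply: climbs0 => //.
by case: v v0 lv.
Qed.

Section ChildrenSum.

Variable phi : bool -> nat -> nat.
Let stat (c : seq nat) := phi (last 0 c == 0) (nactive [::] c).

(** A non-final insertion preserves the active slots from its own position rightwards, and the slot
    in front of the word. Taken from right to left, the active slots before the final one thus lead
    to 3, 4, ... active slots. The default 1 admits an empty [v]. *)
Lemma insertions_sum u v : last 1 v != 0 ->
  \sum_(c <- insertions (0 :: u) v) stat c =
  phi true (nactive [::] (0 :: u ++ v)).+1
  + \sum_(3 <= i < (nactive (0 :: u) v).+2) phi false i.
Proof.
elim: v u => [|a v IH] u lv.
  rewrite /= active_nil /= cats0 big_seq1 big_geq // addn0 /stat.
  by rewrite cats1 -rcons_cons last_rcons nactive_rcons0.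
have lv' : last 1 v != 0 by case: v lv {IH}.
rewrite [insertions _ _]/= big_cat /= IH // cat_rcons.
set n := nactive _ v; have n0 : 0 < n by exact: nactive_gt0.
case: (boolP (active (0 :: u) (a :: v))) => [av|_]; last first.
  by rewrite andbF big_nil.
have v0 : 0 \notin a :: v by apply: active0N av; rewrite ?inE.
rewrite v0 big_seq1 -[true + n]/n.+1 [X in _ = _ + X]big_nat_recr // addnCA.
congr (_ + _).
rewrite addnC; congr (_ + _); rewrite /stat -cat_cons last_cat.
have -> : last (last 0 (0 :: u)) (0 :: a :: v) == 0 = false by apply/negbTE.
congr (phi _ _); rewrite /= nactive_insert ?inE //.
by rewrite cat1s -[nactive _ _]/(active (0 :: u) (a :: v) + n) av.
Qed.

(** Every slot but the final one has the last 0 to its right, so only appending is possible. *)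
Lemma insertions_sum0 u v : last 1 v = 0 ->
  \sum_(c <- insertions (0 :: u) v) stat c =
  phi true (nactive [::] (0 :: u ++ v)).+1.
Proof.
elim: v u => // a v IH u lv.
have v0 : 0 \in a :: v by have := mem_last a v; rewrite [last a v]lv.
rewrite [insertions _ _]/= v0 /=; case: v lv IH {v0} => [/= -> _|b v lv IH].
  rewrite active_nil /= big_seq1 cats1 /stat -rcons_cons.
  by rewrite last_rcons nactive_rcons0 cats1.
by rewrite IH // cat_rcons.
Qed.

Lemma children_sum w : avoiding_rgf w -> w <> [::] ->
  \sum_(c <- children w) stat c =
  phi false (nactive [::] w).+1 + phi true (nactive [::] w).+1 +
  (if last 0 w == 0 then 0
   else \sum_(3 <= i < (nactive [::] w).+1) phi false i).
Proof.
case: w => // a w gw _; have a0 := avoiding_rgf_head gw; subst a.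
rewrite big_cons -addnA; congr (_ + _).
  rewrite /stat; congr (phi _ _); first by rewrite /= (last_map succn w 0).
  exact: (congr1 succn (nactive_succ [::] (0 :: w))).
case: (eqVneq (last 1 w) 0) => [lw|lw].
  rewrite insertions_sum0 //= (_ : last 0 w = 0) ?addn0 //.
  by case: w lw {gw}.
rewrite insertions_sum //; congr (_ + _).
(* The word 0 falls in this case through the default 1, although it ends in 0; it has two active
   slots, so the sum is empty. *)
case: w lw {gw} => [|b w] /= lw; first by rewrite big_geq.
by rewrite (negPf lw).
Qed.

End ChildrenSum.

Lemma size_descendants r s : all (fun w => avoiding_rgf w && (w != [::])) s ->
  size (descendants r s) =
  \sum_(w <- s) continuations r (last 0 w == 0) (nactive [::] w).
Proof.
elim: r s => [|r IH] s gs; first by rewrite sum1_size.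
rewrite [descendants _ _]/= IH.
  rewrite big_flatten big_map big_seq [RHS]big_seq; apply: eq_bigr => w.
  move/(allP gs)/andP => [gw /eqP wn].
  by rewrite (children_sum (continuations r) gw wn).
apply/allP => c /flatten_mapP[w /(allP gs)/andP[gw _] /(children_avoiding_rgf gw)].
by case/andP => -> /=; case: c.
Qed.

Lemma size_generation r : size (generation r) = continuations r true 2.
Proof. by rewrite size_descendants // big_seq1. Qed.

(** * Ascent sequences and restricted growth functions *)

Definition pattern1012 (w : seq nat) : Prop :=
  exists i j k l, [/\ i < j, j < k, k < l & l < size w] /\
    [/\ nth 0 w i = nth 0 w k, nth 0 w j < nth 0 w i & nth 0 w k < nth 0 w l].

Lemma containsP w : reflect (pattern1012 w) (contains w [:: 1; 0; 1; 2]).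
Proof.
apply: (iffP existsP) => [[f /andP[/forallP inc /forallP ord]]|].
  pose o k (h : k < 4) : 'I_4 := Ordinal h.
  have I (i j : 'I_4) : i < j -> f i < f j.
    by move: (inc i) => /forallP /(_ j) /implyP; apply.
  have O (i j : 'I_4) := forallP (ord i) j.
  exists (f (@o 0 isT)), (f (@o 1 isT)), (f (@o 2 isT)), (f (@o 3 isT)).
  split; first by split; [exact: I|exact: I|exact: I|].
  have /andP[/eqP a1 /eqP a2] := O (@o 0 isT) (@o 2 isT).
  have /andP[/eqP b1 /eqP b2] := O (@o 0 isT) (@o 1 isT).
  have /andP[/eqP c1 /eqP c2] := O (@o 2 isT) (@o 3 isT).
  split; [|by rewrite b2|by rewrite c1].
  by move: a1 a2; case: ltngtP.
case=> i [j [k [l [[ij jk kl ls] [e1 e2 e3]]]]].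
have ks := ltn_trans kl ls; have js := ltn_trans jk ks; have is_ := ltn_trans ij js.
exists [ffun x : 'I_4 =>
  nth (Ordinal ls) [:: Ordinal is_; Ordinal js; Ordinal ks; Ordinal ls] x].
apply/andP; split; apply/forallP => x; apply/forallP => y; rewrite !ffunE.
  by case: x => -[|[|[|[|//]]]] ?; case: y => -[|[|[|[|//]]]] ? //=; lia.
by case: x => -[|[|[|[|//]]]] ?; case: y => -[|[|[|[|//]]]] ? //=; lia.
Qed.

Lemma climbsP b s : reflect
  (exists i j, [/\ i < j, j < size s, nth 0 s i = b & b < nth 0 s j])
  (climbs b s).
Proof.
elim: s => [|x s IH] /=; first by apply: (iffP idP) => // -[i [j []]].
case: eqP => [->|xb].
  apply: (iffP (has_nthP 0)) => [[j js bj]|[[|i] [[|j] []]]] //.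
  - by exists 0, j.+1.
  - by move=> _ js _ bj; exists j.
  - by move=> _ js _ bj; exists j.
apply: (iffP IH) => [[i [j [ij js e bj]]]|[[|i] [[|j] []]]] //.
- by exists i.+1, j.+1.
- by move=> ij js e bj; exists i, j.
Qed.

Lemma avoids1012_afterP u v : reflect
  (forall i b, i < size v -> b \in u ++ take i v -> nth 0 v i < b ->
     ~~ climbs b (drop i.+1 v))
  (avoids1012_after u v).
Proof.
elim: v u => [|a v IH] u /=; first by apply: (iffP idP).
apply: (iffP andP) => [[/allP h /IH h'] [|i] b|h].
- by rewrite drop0 cats0 /= => _ /h /implyP.
- by rewrite ltnS /= -cat_rcons; exact: h'.
split; last first.
  by apply/IH => i b iv; rewrite cat_rcons => bi ab; exact: (h i.+1 b).
apply/allP => b bu; apply/implyP => ab.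
by have := h 0 b isT; rewrite cats0 drop0; apply.
Qed.

Lemma avoids1012P w : reflect (~ pattern1012 w) (avoids1012_after [::] w).
Proof.
apply: (iffP (avoids1012_afterP _ _)) => [h|h i b iw].
  case=> i [j [k [l [[ij jk kl ls] [e1 e2 e3]]]]].
  have js : j < size w by lia.
  have := h j (nth 0 w i) js; rewrite cat0s => h1.
  have it : nth 0 w i \in take j w.
    by rewrite -(nth_take 0 ij) mem_nth // size_take js.
  have /negP := h1 it e2; apply; apply/climbsP.
  exists (k - j.+1), (l - j.+1); rewrite !nth_drop size_drop.
  have -> : j.+1 + (k - j.+1) = k by lia.
  have -> : j.+1 + (l - j.+1) = l by lia.
  by rewrite e1; split=> //; lia.
rewrite cat0s => /(nthP 0)[i']; rewrite size_takel ?(ltnW iw) // => i'i.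
rewrite nth_take // => eb ib; apply/climbsP => -[j [k []]].
rewrite size_drop !nth_drop => jk ks ej bk; apply: h.
exists i', i, (i.+1 + j), (i.+1 + k); rewrite eb ej; split; split=> //; lia.
Qed.

(** One more than the maximum, and 0 for the empty word, as in [rgf_from]; for a restricted growth
    function this is the number of distinct letters. *)
Definition nvalues (w : seq nat) : nat := \max_(a <- w) a.+1.

Lemma rgf_rcons m w a :
  rgf_from m (rcons w a) = rgf_from m w && (a <= maxn m (nvalues w)).
Proof.
elim: w m => [|x w IH] m /=; first by rewrite /nvalues big_nil maxn0 andbT.
by rewrite IH -andbA /nvalues big_cons maxnA.
Qed.

Lemma nvalues_rcons w a : nvalues (rcons w a) = maxn (nvalues w) a.+1.
Proof. by rewrite /nvalues -cats1 big_cat big_seq1. Qed.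

Lemma ltn_nvalues w a : a \in w -> a < nvalues w.
Proof. by move=> aw; rewrite /nvalues (big_rem a) //= leq_maxl. Qed.

Lemma rgf_mem w a : rgf_from 0 w -> a < nvalues w -> a \in w.
Proof.
elim/last_ind: w => [|w x IH]; first by rewrite /nvalues big_nil.
rewrite rgf_rcons max0n nvalues_rcons mem_rcons inE => /andP[rw xw] h.
by case: (ltnP a (nvalues w)) => [/(IH rw) ->|aw]; rewrite ?orbT //; apply/orP; left; lia.
Qed.

Lemma asc_rcons w x a : asc (rcons (rcons w x) a) = asc (rcons w x) + (x < a).
Proof.
rewrite /asc !size_rcons /= big_ord_recr /= !nth_rcons !size_rcons ltnn eqxx ltnSn.
rewrite ltnn eqxx; congr (_ + _); apply: eq_bigr => i _.
by rewrite !(nth_rcons _ (rcons w x)) size_rcons !ltnS ltn_ord (ltnW (ltn_ord i)).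
Qed.

Lemma asc_seq1 a : asc [:: a] = 0.
Proof. by rewrite /asc big_ord0. Qed.

Lemma ascent_seq_rcons w x a :
  ascent_seq (rcons (rcons w x) a) =
  ascent_seq (rcons w x) && (a <= asc (rcons w x) + 1).
Proof.
set v := rcons w x; have v0 : 0 < size v by rewrite size_rcons.
rewrite /ascent_seq nth_rcons v0 -andbA; congr (_ && _).
apply/forallP/andP => [h|[/forallP h ha] [i /=]].
  split.
    apply/forallP => i; apply/implyP => i0.
    have iv : i < size (rcons v a) by rewrite size_rcons ltnW // ltnS.
    have := implyP (h (Ordinal iv)) i0.
    by rewrite /= nth_rcons ltn_ord -cats1 takel_cat // ltnW.
  have sv : size v < size (rcons v a) by rewrite size_rcons.
  have := implyP (h (Ordinal sv)) v0.
  by rewrite /= nth_rcons ltnn eqxx -cats1 take_size_cat.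
rewrite size_rcons ltnS leq_eqVlt => /orP[/eqP ->|iv]; apply/implyP => i0.
  by rewrite nth_rcons ltnn eqxx -cats1 take_size_cat.
rewrite nth_rcons iv -cats1 takel_cat ?(ltnW iv) //.
exact: (implyP (h (Ordinal iv)) i0).
Qed.

Lemma rgf_nvalues_asc w : rgf_from 0 w -> nvalues w <= (asc w).+1.
Proof.
elim/last_ind: w => [|w a IH]; first by rewrite /nvalues big_nil.
case/lastP: w IH => [_|w x IH].
  by rewrite rgf_rcons nvalues_rcons /nvalues big_nil => /andP[_]; lia.
rewrite rgf_rcons max0n => /andP[rw aw]; rewrite asc_rcons nvalues_rcons.
have := IH rw; move: aw; rewrite nvalues_rcons; lia.
Qed.

(** Either all ascents lead to new maxima, or some ascent [a b] leads to a letter [b] already used.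
    The [maxn 1] covers the empty word. *)
Lemma rgf_asc w : rgf_from 0 w ->
  (asc w).+1 <= maxn 1 (nvalues w) \/
  exists i j, [/\ i < j, j.+1 < size w, nth 0 w i = nth 0 w j.+1
                & nth 0 w j < nth 0 w i].
Proof.
elim/last_ind: w => [|w a IH]; first by left; rewrite /asc big_ord0 leq_maxl.
case/lastP: w IH => [_|w x IH]; first by rewrite asc_seq1; left; lia.
rewrite rgf_rcons max0n => /andP[rw aw].
set v := rcons w x in IH rw aw *.
have lift i : i < size v -> nth 0 (rcons v a) i = nth 0 v i.
  by move=> iv; rewrite nth_rcons iv.
case: (IH rw) => [h|[i [j [ij js e1 e2]]]]; last first.
  by right; exists i, j; rewrite size_rcons !lift; try lia; split=> //; lia.
rewrite asc_rcons nvalues_rcons -/v.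
case: (ltnP x a) => xa; last by left; lia.
case: (ltnP a (nvalues v)) => av; last first.
  have : 0 < nvalues v by rewrite nvalues_rcons; lia.
  by left; lia.
(* As [a] is not a new maximum it has occurred before, and not at the position of [x] because
   [x < a]. *)
right; have /(nthP 0)[i iv ei] := rgf_mem rw av.
have sv : size v = (size w).+1 by rewrite size_rcons.
have vx : nth 0 v (size w) = x by rewrite nth_rcons ltnn eqxx.
have iw : i != size w by apply: contraTneq xa => e; rewrite -ei e vx ltnn.
have la : nth 0 (rcons v a) (size w).+1 = a by rewrite nth_rcons sv ltnn eqxx.
exists i, (size w); rewrite la lift // lift ?sv // ei vx size_rcons sv.
by split=> //; rewrite ltn_neqAle iw -ltnS -sv.
Qed.

Lemma pattern1012_rcons w a : pattern1012 w -> pattern1012 (rcons w a).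
Proof.
case=> i [j [k [l [[ij jk kl ls] [e1 e2 e3]]]]]; exists i, j, k, l.
by rewrite size_rcons !nth_rcons !ifT; try lia; split; split=> //; lia.
Qed.

(** A letter that skips a value requires more ascents than new maxima, hence by [rgf_asc] an earlier
    factor [b .. a b] with [a < b]; the skipping letter exceeds [b] and completes a 1012. *)
Lemma ascent_rgf w : ascent_seq w -> ~ pattern1012 w -> rgf_from 0 w.
Proof.
elim/last_ind: w => // w a IH; case/lastP: w IH => [_|w x IH].
  by rewrite /ascent_seq /= => /andP[/eqP ->].
rewrite ascent_seq_rcons => /andP[aw ha] np.
have rw : rgf_from 0 (rcons w x).
  by apply: IH => // p; apply: np; apply: pattern1012_rcons.
have nv : 0 < nvalues (rcons w x) by rewrite nvalues_rcons; lia.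
rewrite rgf_rcons max0n rw /=; case: (rgf_asc rw) => [|[i [j [ij js e1 e2]]]].
  by lia.
rewrite leqNgt; apply/negP => na; apply: np.
set v := rcons w x in js e1 e2 na *.
have lift k : k < size v -> nth 0 (rcons v a) k = nth 0 v k.
  by move=> kv; rewrite nth_rcons kv.
have vj := ltn_nvalues (mem_nth 0 js).
have la : nth 0 (rcons v a) (size v) = a by rewrite nth_rcons ltnn eqxx.
exists i, j, j.+1, (size v); rewrite la size_rcons !lift; try lia.
by split; split=> //; exact: ltn_trans na.
Qed.

Lemma rgf_ascent w : rgf_from 0 w -> ascent_seq w.
Proof.
elim/last_ind: w => [|w a IH]; first by move=> _; apply/andP; split=> //;
  apply/forallP => -[].
case/lastP: w IH => [_|w x IH].
  rewrite /ascent_seq /= leqn0 andbT => -> /=; apply/forallP => -[i /= i1].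
  by apply/implyP; lia.
rewrite rgf_rcons max0n ascent_seq_rcons => /andP[rw aw].
by rewrite IH // addn1 (leq_trans aw) ?rgf_nvalues_asc.
Qed.

Lemma avoiding_rgf_ascent w :
  avoiding_rgf w = ascent_seq w && avoids w [:: 1; 0; 1; 2].
Proof.
apply/andP/andP => [[h /avoids1012P np]|[h /containsP np]]; split.
- exact: rgf_ascent.
- exact/containsP.
- exact: ascent_rgf.
- exact/avoids1012P.
Qed.

Lemma A1012_continuations r : A [:: 1; 0; 1; 2] r.+1 = continuations r true 2.
Proof.
have [s [us ms <-]] := A_spec [:: 1; 0; 1; 2] r.+1.
rewrite -size_generation; apply/perm_size/uniq_perm => //.
  exact: generation_uniq.
by move=> w; rewrite ms mem_generation avoiding_rgf_ascent andbC.
Qed.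

(** * Solving the recurrence *)

Lemma continuationsS r z k : continuations r.+1 z k =
  (continuations r false k.+1 + continuations r true k.+1 +
    (if z then 0 else \sum_(3 <= i < k.+1) continuations r false i))%N.
Proof. by []. Qed.

Lemma catalan_rec i : i.+2 * catalan i.+1 = (4 * i + 2) * catalan i.
Proof.
apply/eqP; rewrite -(eqn_pmul2l (ltn0Sn i)) catalan_exact mulnCA catalan_exact.
have e1 := mul_bin_diag (2 * i.+1) i.
have e2 := mul_bin_down (2 * i).+1 i.
have e3 : (2 * i).+1 - i = i.+1 by lia.
have e4 : (2 * i.+1).-1 = (2 * i).+1 by lia.
rewrite e3 /= in e2; rewrite e4 in e1; rewrite -e1 mulnAC -mulnA [X in _ == X]mulnC.
by apply/eqP; nia.
Qed.

Import GRing.Theory Num.Theory.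
Local Open Scope ring_scope.

(** By the symmetry [i <-> n - i], [\sum_i i C_i C_(n-i)] is [n / 2] times the
    convolution, which turns [catalan_rec] into a recurrence for the latter. *)
Lemma catalan_convolution n :
  (\sum_(0 <= i < n.+1) catalan i * catalan (n - i) = catalan n.+1)%N.
Proof.
pose S n := (\sum_(0 <= i < n.+1) catalan i * catalan (n - i))%N.
pose T n := (\sum_(0 <= i < n.+1) i * (catalan i * catalan (n - i)))%N.
have ST m : (2 * T m = m * S m)%N.
  rewrite mul2n -addnn {1}/T big_nat_rev /= add0n -big_split /= /S big_distrr /=.
  rewrite [LHS]big_nat_cond [RHS]big_nat_cond.
  apply: eq_bigr => i; rewrite andbT /= ltnS => im.
  by rewrite subSS subKn // [(catalan (m - i) * _)%N]mulnC -mulnDl subnK.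
have rec m : (T m.+1 + S m.+1 = catalan m.+1 + 4 * T m + 2 * S m)%N.
  rewrite /T /S -big_split /= big_nat_recl // subn0 mul0n add0n mul1n -addnA.
  congr (_ + _)%N; rewrite !big_distrr /= -big_split /=.
  apply: eq_bigr => i _; rewrite subSS.
  by rewrite -mulSnr mulnA catalan_rec [((4 * i + 2) * _)%N]mulnDl mulnDl !mulnA.
elim: n => [|n IH]; first by rewrite big_nat1.
rewrite -/(S _) in IH; rewrite -/(S n.+1); have := rec n; have := ST n; have := ST n.+1.
have := catalan_rec n.+1; rewrite IH.
move: (S n.+1) (T n) (T n.+1) => s t t' c1 t1 t0 r.
apply/eqP; rewrite -(eqn_pmul2l (ltn0Sn n.+2)) c1; apply/eqP.
(* By [ST] the right side becomes twice the left side of [rec]. *)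
have -> : (n.+3 * s = n.+1 * s + 2 * s)%N by rewrite -mulnDl addn2.
by rewrite -t1 -mulnDr r; lia.
Qed.

(** * The kernel method modulo ['X^N] *)

Section Kernel.

Variable N : nat.
Hypothesis N0 : (0 < N)%N.

Implicit Types p q : {poly rat}.

Lemma dvdXnP p : reflect (forall i, (i < N)%N -> p`_i = 0) ('X^N %| p).
Proof.
apply: (iffP idP) => [/dvdpP[q ->] i iN|h]; first by rewrite coefMXn iN.
rewrite -(poly_take_drop N p) (_ : take_poly N p = 0) ?add0r ?dvdp_mull //.
by apply/polyP => i; rewrite coef_take_poly coef0; case: ifP => // /h.
Qed.

(** Power series modulo [x^N] are represented by polynomials. *)
Definition catalan_poly : {poly rat} := \poly_(i < N) (catalan i)%:R.
Definition geom_poly : {poly rat} := \sum_(i < N) 'X^i.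
Definition Kgf : {poly rat} := catalan_poly \Po ('X * geom_poly).
Definition Hgf : {poly rat} := geom_poly * Kgf.
Definition Mgf : {poly rat} := \sum_(i < N) ('X * Kgf) ^+ i.

Lemma catalan_poly_eq : 'X^N %| catalan_poly - 1 - 'X * catalan_poly ^+ 2.
Proof.
apply/dvdXnP => -[|i] iN; rewrite !coefB coef1 coef_poly iN coefXM /= ?subr0.
  by rewrite /catalan subrr.
rewrite expr2 coefM -catalan_convolution big_mkord natr_sum; apply/eqP.
rewrite subr_eq0; apply/eqP; apply: eq_bigr => j _.
rewrite !coef_poly natrM !ifT //; have := ltn_ord j; lia.
Qed.

Lemma geom_polyE : (1 - 'X) * geom_poly = 1 - 'X^N.
Proof.
by rewrite -[LHS]opprK -mulNr opprB -subrX1 opprB.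
Qed.

(** This is the Catalan equation at [x / (1 - x)], times [1 - x]. The error remains divisible by
    ['X^N] because the polynomial substituted is a multiple of ['X]. *)
Lemma Kgf_eq : 'X^N %| (1 - 'X) * (Kgf - 1) - 'X * Kgf ^+ 2.
Proof.
have [R eR] := dvdpP _ _ catalan_poly_eq.
have := congr1 (fun p => p \Po ('X * geom_poly)) eR.
rewrite !comp_polyB !comp_polyM comp_Xn_poly !comp_polyX rmorph1 -/Kgf -expr2 => e.
have -> : (1 - 'X) * (Kgf - 1) - 'X * Kgf ^+ 2 =
   (1 - 'X) * (Kgf - 1 - 'X * geom_poly * Kgf ^+ 2)
   + 'X * Kgf ^+ 2 * ((1 - 'X) * geom_poly - 1).
  by ring.
rewrite e geom_polyE exprMn.
apply: dvdp_add.
  by rewrite dvdp_mull // dvdp_mull // dvdp_mulIl.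
by rewrite addrAC subrr add0r mulrN dvdpNr dvdp_mulIr.
Qed.

Lemma Hgf_eq : 'X^N %| (1 - 'X) * Hgf - Kgf.
Proof.
rewrite mulrA geom_polyE.
have -> : (1 - 'X^N) * Kgf - Kgf = - ('X^N * Kgf) by ring.
by rewrite dvdpNr dvdp_mulIl.
Qed.

Lemma Mgf_eq : 'X^N %| (1 - 'X * Kgf) * Mgf - 1.
Proof.
have -> : (1 - 'X * Kgf) * Mgf - 1 = - (Kgf ^+ N * 'X^N).
  rewrite -[X in X - 1]opprK -mulNr opprB -subrX1 exprMn.
  by rewrite opprB addrAC subrr add0r mulrC.
by rewrite dvdpNr dvdp_mulIr.
Qed.

Lemma coef0_Kgf : Kgf`_0 = 1.
Proof.
by rewrite -horner_coef0 horner_comp !hornerE horner_coef0 coef_poly N0.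
Qed.

(** This allows [Kgf] to be cancelled modulo ['X^N]. *)
Lemma coprime_Kgf : coprimep 'X^N Kgf.
Proof.
apply: coprimep_expl; rewrite coprimep_sym coprimepX.
by rewrite /root horner_coef0 coef0_Kgf oner_eq0.
Qed.

(** With [j + 2] active slots; [contB_gf] is for the words ending in 0. *)
Definition contA_gf j : {poly rat} := Hgf * Mgf ^+ j.
Definition contB_gf j : {poly rat} :=
  contA_gf j - 'X * \sum_(1 <= i < j.+1) contA_gf i.

Lemma contB_gf0 : contB_gf 0 = Hgf.
Proof. by rewrite /contB_gf big_geq // mulr0 subr0 /contA_gf expr0 mulr1. Qed.

(** Multiplication by [Kgf] sums the geometric progression in [contB_gf], since [x K M = M - 1]
    modulo ['X^N]. *)
Lemma Kgf_contB_gf j : 'X^N %| Kgf * contB_gf j - ((Kgf - 1) * contA_gf j + Hgf).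
Proof.
elim: j => [|j IH].
  rewrite contB_gf0 /contA_gf expr0 (_ : _ - _ = 0) ?dvdp0 //; ring.
have -> : Kgf * contB_gf j.+1 - ((Kgf - 1) * contA_gf j.+1 + Hgf) =
   Kgf * contB_gf j - ((Kgf - 1) * contA_gf j + Hgf)
   + contA_gf j * ((1 - 'X * Kgf) * Mgf - 1).
  by rewrite /contB_gf big_nat_recr //= /contA_gf exprS; ring.
by rewrite dvdp_add ?dvdp_mull ?Mgf_eq.
Qed.

(** The recurrence of [continuations] for words ending in 0. Multiplied by [Kgf], with both
    [contB_gf] eliminated, it is a combination of the defining equations of [Hgf], [Mgf] and
    [Kgf]. *)
Lemma contB_gf_rec j : 'X^N %| contB_gf j - 1 - 'X * (contB_gf j.+1 + contA_gf j.+1).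
Proof.
rewrite -(Gauss_dvdpr _ coprime_Kgf).
have -> : Kgf * (contB_gf j - 1 - 'X * (contB_gf j.+1 + contA_gf j.+1)) =
  (Kgf * contB_gf j - ((Kgf - 1) * contA_gf j + Hgf))
  - 'X * (Kgf * contB_gf j.+1 - ((Kgf - 1) * contA_gf j.+1 + Hgf))
  + ((1 - 'X) * Hgf - Kgf)
  - (Kgf - 1) * contA_gf j * ((1 - 'X * Kgf) * Mgf - 1)
  + contA_gf j.+1 * ((1 - 'X) * (Kgf - 1) - 'X * Kgf ^+ 2).
  by rewrite /contA_gf exprS; ring.
apply: dvdp_add (dvdp_mull _ Kgf_eq); apply: dvdp_sub (dvdp_mull _ Mgf_eq).
apply: dvdp_add Hgf_eq; apply: dvdp_sub (dvdp_mull _ (Kgf_contB_gf _)).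
exact: Kgf_contB_gf.
Qed.

(** The series [x^i / (1 - x)^(i + 1)] generates a column of Pascal's triangle; multiplying by
    [1 - x] gives Pascal's rule. *)
Lemma coef_geom_polyX i r : (r < N)%N ->
  (geom_poly * ('X * geom_poly) ^+ i)`_r = ('C(r, i))%:R.
Proof.
elim: i r => [|i IH] r rN.
  rewrite expr0 mulr1 bin0 coef_sum (bigD1 (Ordinal rN)) //= coefXn eqxx.
  rewrite big1 ?addr0 // => k /negPf; rewrite coefXn => h.
  by rewrite eq_sym -[_ == _]/(_ == Ordinal rN) h.
have e : (1 - 'X) * (geom_poly * ('X * geom_poly) ^+ i.+1) =
         'X * (geom_poly * ('X * geom_poly) ^+ i) * (1 - 'X^N).
  by rewrite -geom_polyE exprS; ring.
elim: r rN => [|r IHr] rN.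
  move/(congr1 (fun p => p`_0)): e.
  by rewrite mulrBl mul1r coefB -mulrA !coefXM subr0 bin0n => ->.
move/(congr1 (fun p => p`_r.+1)): e.
rewrite mulrBl mul1r mulrBr mulr1 !coefB coefMXn rN subr0 !coefXM /=.
rewrite IH ?IHr 1?ltnW // => /eqP; rewrite subr_eq => /eqP ->.
by rewrite -natrD binS addnC.
Qed.

Lemma coef_Hgf r : (r < N)%N ->
  Hgf`_r = (\sum_(0 <= i < N) 'C(r, i) * catalan i)%N%:R.
Proof.
move=> rN; rewrite /Hgf /Kgf /catalan_poly poly_def raddf_sum /= mulr_sumr coef_sum.
rewrite big_mkord natr_sum; apply: eq_bigr => i _.
rewrite comp_polyZ comp_Xn_poly -scalerAr coefZ coef_geom_polyX // natrM.
by rewrite mulrC.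
Qed.

Lemma coef_cont_gf r z j : (r < N)%N ->
  (continuations r z j.+2)%:R = (if z then contB_gf j else contA_gf j)`_r.
Proof.
elim: r z j => [|r IH] z j rN.
  have B0 i : (contB_gf i)`_0 = 1.
    have := elimT (dvdXnP _) (contB_gf_rec i) _ N0.
    rewrite coefB coefB coef1 coefXM subr0 => /eqP.
    by rewrite subr_eq0 => /eqP.
  rewrite /=; case: z; rewrite ?B0 //.
  by have := B0 j; rewrite /contB_gf coefB coefXM subr0 => ->.
have IHA i : (continuations r false i.+2)%:R = (contA_gf i)`_r by rewrite IH // ltnW.
have IHB i : (continuations r true i.+2)%:R = (contB_gf i)`_r by rewrite IH // ltnW.
have B i : (continuations r.+1 true i.+2)%:R = (contB_gf i)`_r.+1.
  have := elimT (dvdXnP _) (contB_gf_rec i) _ rN.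
  rewrite coefB coefB coef1 coefXM subr0 /= [(contB_gf i.+1 + _)`_r]coefD -IHA -IHB.
  by move=> /eqP; rewrite subr_eq0 => /eqP ->; rewrite addn0 -natrD addnC.
case: z; first exact: B.
(* A word not ending in 0 has the non-final insertions in addition, and their contribution is the
   sum subtracted in [contB_gf]. *)
rewrite continuationsS natrD; have := B j; rewrite continuationsS addn0 => ->.
rewrite /contB_gf coefB coefXM /= coef_sum natr_sum.
rewrite (big_addn 1 _ 2) !subSS subn0.
by under eq_bigr => i _ do rewrite addn2 IHA; rewrite subrK.
Qed.

End Kernel.

Local Close Scope ring_scope.

Theorem theorem3 (n : nat) (hn : 1 <= n) :
  A [:: 1; 0; 1; 2] n = \sum_(0 <= i < n) 'C(n.-1, i) * catalan i.
Proof.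
case: n hn => // r _; rewrite A1012_continuations.
(* The truncation order is [r.+1], which retains degree [r] and gives the sum its bound; index 0
   stands for two active slots. *)
apply/eqP; rewrite -(eqr_nat rat) (coef_cont_gf _ true 0 (ltnSn r)) //.
by rewrite contB_gf0 coef_Hgf.
Qed.
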